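(* There is a theory $T$, namely the model completion of the universal theory $T^{\forall}$ described in the context, which is NSOP$_4$ and has SOP$_3$, such that the following condition holds for $\Delta = \{R_{0,2}(x,y)\}$, with $\theta(x,z) = R_{0,1}(x,z)$ as the formula associated to $\varphi(x,y) = R_{0,2}(x,y)$: for every $M \models T$, every finite $\varphi$-type $r(x)$ over $M$ and every finite set $A \subseteq M$ of realizations of $r$, there is some $b \in M$ such that $M \models R_{0,1}(a,b)$ for all $a \in A$ and $R_{0,1}(x,b) \vdash r(x)$. Thus $T$ has singular compactness for $\Delta$: whenever $M \models T$ is $\mu$-saturated for a singular cardinal $\mu > |T|$, every $\Delta$-type over a set $A \subseteq M$ with $|A| \leq \mu$ is realized in $M$.
   Context: The language is $L = \{P_0,P_1,P_2\} \cup \{R_{0,1},R_{0,2},R_{1,2}\}$ with $P_i$ unary predicates and $R_{i,j}$ binary relation symbols. $T^{\forall}$ says that $P_0,P_1,P_2$ are disjoint and their union covers the universe, that $R_{i,j} \subseteq P_i \times P_j$, and that if $R_{1,2}(b,c)$ then $(\forall x)[R_{0,1}(x,b) \to R_{0,2}(x,c)]$. $T^{\forall}$ is universal with the amalgamation and joint embedding properties, and it has a model completion $T$, which has quantifier elimination. For a set $\Delta$ of formulas over $\emptyset$, a (partial) $\Delta$-type is a consistent set of (positive) instances of formulas from $\Delta$; a $\varphi$-type is a $\{\varphi\}$-type (so here a consistent set of formulas of the form $R_{0,2}(x,c)$). For $n \geq 3$, a theory $T$ has SOP$_n$ if there is a formula $\varphi(x;y)$ and a sequence of tuples $\langle a_i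 : i<\omega\rangle$ (in a model of $T$) such that $\models \varphi(a_i;a_j)$ if and only if $i<j$, and $\{\varphi(x_i,x_{i+1}) : i<n-1\} \cup \{\varphi(x_{n-1},x_0)\}$ is inconsistent (with $T$); otherwise $T$ is NSOP$_n$.
   Formalization: The finite φ-type r(x) in the covering condition is taken to be nonempty: for r empty every element of M realizes r, and A = {a} with a in P_1 would need R_{0,1}(a,b), contradicting R_{0,1} ⊆ P_0 × P_1. *)

(* Defs.v *)
From mathcomp Require Import all_boot.
From mathcomp Require Import boolp classical_sets functions cardinality wochoice.
Set Implicit Arguments. Unset Strict Implicit. Unset Printing Implicit Defensive.
Local Open Scope classical_set_scope.
Local Open Scope card_scope.

(* First-order logic with equality over a relational language. *)

Record language := Language { symbol : Type; arity : symbol -> nat }.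

(* [form L V]: L-formulas whose free variables lie in V; a quantifier binds the
   variable [None] of [option V]. With V := 'I_n + M these are the formulas in
   n variables with parameters from M; with V := void, the sentences. *)
Inductive form (L : language) (V : Type) : Type :=
| Bot
| Eq of V & V
| Rel (r : symbol L) of ('I_(arity r) -> V)
| And of form L V & form L V
| Or of form L V & form L V
| Imp of form L V & form L V
| All of form L (option V)
| Ex of form L (option V).
Arguments Bot {L V}.

Definition Not L V (f : form L V) : form L V := Imp f Bot.

Fixpoint fmap L V W (s : V -> W) (f : form L V) : form L W :=
  match f with
  | Bot => Bot
  | Eq x y => Eq L (s x) (s y)
  | Rel r v => Rel (s \o v)
  | And g h => And (fmap s g) (fmap s h)
  | Or g h => Or (fmap s g) (fmap s h)
  | Imp g h => Imp (fmap s g) (fmap s h)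
  | All g => All (fmap (omap s) g)
  | Ex g => Ex (fmap (omap s) g)
  end.

(* Every free variable of the formula lies in Q. *)
Fixpoint fv_in L V (Q : set V) (f : form L V) : Prop :=
  let Q' := fun o : option V => if o is Some v then Q v else True in
  match f with
  | Bot => True
  | Eq x y => Q x /\ Q y
  | Rel r v => forall i, Q (v i)
  | And g h => fv_in Q g /\ fv_in Q h
  | Or g h => fv_in Q g /\ fv_in Q h
  | Imp g h => fv_in Q g /\ fv_in Q h
  | All g => fv_in Q' g
  | Ex g => fv_in Q' g
  end.

Record struc (L : language) := Struc {
  carrier :> Type;
  interp : forall r : symbol L, ('I_(arity r) -> carrier) -> Prop;
  carrier_nonempty : inhabited carrier }.

Fixpoint sat L (M : struc L) V (e : V -> M) (f : form L V) : Prop :=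
  let ext (e : V -> M) (a : M) := fun o => if o is Some v then e v else a in
  match f with
  | Bot => False
  | Eq x y => e x = e y
  | Rel r v => interp (e \o v)
  | And g h => sat e g /\ sat e h
  | Or g h => sat e g \/ sat e h
  | Imp g h => sat e g -> sat e h
  | All g => forall a, sat (ext e a) g
  | Ex g => exists a, sat (ext e a) g
  end.

Definition theory (L : language) := set (form L void).

Definition models L (M : struc L) (T : theory L) :=
  forall s, T s -> sat (of_void M) s.

Definition embedding L (M N : struc L) (h : M -> N) :=
  injective h /\
  forall (r : symbol L) (v : 'I_(arity r) -> M), interp v <-> interp (h \o v).

(* N, with h interpreting the constants, is a model of Th(M_M). *)
Definition elementary L (M N : struc L) (h : M -> N) :=
  forall f : form L M, sat id f -> sat h f.

(* The last clause says that T' together with the (quantifier-free) diagram of M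
   is complete, for every model M of T. *)
Definition model_completion L (T T' : theory L) :=
  [/\ forall M : struc L, models M T' -> models M T,
      forall M : struc L, models M T ->
        exists (N : struc L) (h : M -> N), models N T' /\ embedding h
    & forall M : struc L, models M T ->
      forall (N1 N2 : struc L) (h1 : M -> N1) (h2 : M -> N2),
        models N1 T' -> embedding h1 -> models N2 T' -> embedding h2 ->
        forall f : form L M, sat h1 f <-> sat h2 f].

(* Evaluation of a partitioned formula f(x;y) at a pair of tuples. *)
Definition sat2 L (M : struc L) n k (f : form L ('I_n + 'I_k))
    (a : 'I_n -> M) (b : 'I_k -> M) : Prop :=
  sat (fun v => match v with inl i => a i | inr j => b j end) f.

Definition SOP (n : nat) L (T : theory L) :=
  exists (k : nat) (f : form L ('I_k + 'I_k)),
    (exists (M : struc L) (a : nat -> 'I_k -> M),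
       models M T /\ forall i j : nat, sat2 f (a i) (a j) <-> (i < j)%N)
    /\ ~ (exists (N : struc L) (x : nat -> 'I_k -> N),
            [/\ models N T,
                forall i, (i < n.-1)%N -> sat2 f (x i) (x i.+1)
              & sat2 f (x n.-1) (x 0%N)]).

Definition NSOP (n : nat) L (T : theory L) := ~ SOP n T.

Definition pset L (M : struc L) n := set (form L ('I_n + M)).

(* N, with h interpreting the parameters, satisfies all formulas of p at a. *)
Definition realizes_in L (M N : struc L) (h : M -> N) n (a : 'I_n -> N)
    (p : pset M n) :=
  forall f, p f -> sat (fun v => match v with inl i => a i | inr c => h c end) f.

Definition realizes L (M : struc L) n (a : 'I_n -> M) (p : pset M n) :=
  realizes_in (@id M) a p.

(* Consistency and entailment are modulo Th(M_M). *)
Definition consistent L (M : struc L) n (p : pset M n) :=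
  exists (N : struc L) (h : M -> N) (a : 'I_n -> N),
    elementary h /\ realizes_in h a p.

Definition entails L (M : struc L) n (p q : pset M n) :=
  forall (N : struc L) (h : M -> N) (a : 'I_n -> N),
    elementary h -> realizes_in h a p -> realizes_in h a q.

Definition over L (M : struc L) n (A : set M) (f : form L ('I_n + M)) :=
  fv_in (fun v => match v with inl _ => True | inr c => A c end) f.

Definition complete_type L (M : struc L) n (A : set M) (p : pset M n) :=
  [/\ p `<=` over A,
      consistent p
    & forall f : form L ('I_n + M), over A f -> p f \/ p (Not f)].

(* A formula f(x;y) with x of length n, packed with the length of y. *)
Definition pform L n := {k : nat & form L ('I_n + 'I_k)}.

(* The instance f(x;c). *)
Definition inst L (M : struc L) n k (f : form L ('I_n + 'I_k)) (c : 'I_k -> M) :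
    form L ('I_n + M) :=
  fmap (fun v => match v with inl i => inl i | inr j => inr (c j) end) f.

Definition delta_type L (M : struc L) n (D : set (pform L n)) (A : set M)
    (p : pset M n) :=
  consistent p /\
  forall g, p g -> exists (f : pform L n) (c : 'I_(projT1 f) -> M),
    [/\ D f, forall j, A (c j) & g = inst (projT2 f) c].

Definition card_lt T U (A : set T) (B : set U) := A #<= B /\ ~ (B #<= A).

(* Cardinals as initial ordinals: well-ordered types all of whose proper initial
   segments have strictly smaller cardinality. *)
Record cardinal := Cardinal {
  csort :> Type;
  cle : rel csort;
  cle_wo : well_order cle;
  cle_initial : forall x : csort,
    card_lt [set y | cle y x /\ y <> x] [set: csort] }.

(* mu is infinite and cf(mu) < mu. *)
Definition singular (mu : cardinal) :=
  infinite_set [set: mu] /\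
  exists C : set mu,
    (forall x, exists y, C y /\ cle x y) /\ card_lt C [set: mu].

Definition saturated L (mu : cardinal) (M : struc L) :=
  forall (A : set M), card_lt A [set: mu] ->
  forall n (p : pset M n), complete_type A p -> exists a, realizes a p.

(* |T| is the number of L-formulas, that is |L| + aleph_0. *)
Definition singular_compactness L (T : theory L) n (D : set (pform L n)) :=
  forall (M : struc L) (mu : cardinal),
    models M T -> singular mu -> card_lt [set: form L nat] [set: mu] ->
    saturated mu M ->
    forall A : set M, A #<= [set: mu] ->
    forall p : pset M n, delta_type D A p -> exists a, realizes a p.

Inductive sym3 := P0 | P1 | P2 | R01 | R02 | R12.

Definition L3 : language :=
  Language (fun s => match s with P0 | P1 | P2 => 1 | R01 | R02 | R12 => 2 end).

Definition pair_fun V (x y : V) : 'I_2 -> V :=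
  fun i => if i == ord0 then x else y.

Section Atoms.
Variable V : Type.
Implicit Types x y : V.
Definition fP0 x : form L3 V := @Rel L3 V P0 (fun=> x).
Definition fP1 x : form L3 V := @Rel L3 V P1 (fun=> x).
Definition fP2 x : form L3 V := @Rel L3 V P2 (fun=> x).
Definition fR01 x y : form L3 V := @Rel L3 V R01 (pair_fun x y).
Definition fR02 x y : form L3 V := @Rel L3 V R02 (pair_fun x y).
Definition fR12 x y : form L3 V := @Rel L3 V R12 (pair_fun x y).
End Atoms.

Inductive Tforall : theory L3 :=
| T_disj01 : Tforall (All (Not (And (fP0 None) (fP1 None))))
| T_disj02 : Tforall (All (Not (And (fP0 None) (fP2 None))))
| T_disj12 : Tforall (All (Not (And (fP1 None) (fP2 None))))
| T_cover : Tforall (All (Or (fP0 None) (Or (fP1 None) (fP2 None))))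
| T_R01 : Tforall (let x := Some None in let y := None in
    All (All (Imp (fR01 x y) (And (fP0 x) (fP1 y)))))
| T_R02 : Tforall (let x := Some None in let y := None in
    All (All (Imp (fR02 x y) (And (fP0 x) (fP2 y)))))
| T_R12 : Tforall (let x := Some None in let y := None in
    All (All (Imp (fR12 x y) (And (fP1 x) (fP2 y)))))
| T_triangle : Tforall (
    All (* b *) (All (* c *) (Imp (fR12 (Some None) None)
      (All (* x *) (let x := None in
                    let c := Some None in let b := Some (Some None) in
        Imp (fR01 x b) (fR02 x c)))))).

(* R02(x;y) and R01(x;z), partitioned with x, y, z single variables. *)
Definition phi : form L3 ('I_1 + 'I_1) := fR02 (inl ord0) (inr ord0).
Definition theta : form L3 ('I_1 + 'I_1) := fR01 (inl ord0) (inr ord0).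

Definition Delta : set (pform L3 1) := [set existT _ 1%N phi].

(* Main.v *)
(* A back-and-forth argument shows that [T], the theory of the models of [Tforall] realizing every
   finite one-point extension, decides the type of a tuple from its atomic type.  A model of
   [Tforall] embeds in a model of [T]: freely adjoin, again and again, elements with prescribed
   relations to finitely many older ones.  SOP_3 comes from triples [(a_i, b_i, c_i)] with
   [R01(a_i, b_j)], [R12(b_i, c_j)] for [i < j] and no [R02(a_j, c_i)]: closing up a 3-cycle
   violates the composition axiom.  A 4-cycle can always be closed up: given [a], [b], [c] with the
   same atomic type on the three pairs (Ramsey), glue four copies of the type of [(a, b)] around a
   4-cycle; since it contains no triangle, composing [R01] and [R12] only creates [R02] between
   opposite vertices, or where it already held.
   For singular compactness, cut the parameters [c] into few small pieces and take, by saturation,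
   [b_i] with [R12(b_i, c)] for all [c] in the [i]-th piece; the [R01(x, b_i)] are always
   simultaneously realizable and imply [R02(x, c)] for all [c]. *)
From Stdlib Require List.
Require Import Defs.
From mathcomp Require Import all_boot.
From mathcomp Require Import boolp classical_sets functions cardinality.
Set Implicit Arguments.
Unset Strict Implicit.
Unset Printing Implicit Defensive.
Local Open Scope classical_set_scope.
Local Open Scope card_scope.

(** * Back-and-forth *)

(** Equality of atomic types: [e1 v |-> e2 v] is an isomorphism between the substructures induced on
    the two ranges. *)
Definition agree L (M N : struc L) V (e1 : V -> M) (e2 : V -> N) :=
  (forall u v, e1 u = e1 v <-> e2 u = e2 v) /\
  forall (r : symbol L) (w : 'I_(arity r) -> V),
    interp (e1 \o w) <-> interp (e2 \o w).

Lemma agree_sym L (M N : struc L) V (e1 : V -> M) (e2 : V -> N) :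
  agree e1 e2 -> agree e2 e1.
Proof.
by case=> Heq Hrel; split=> *; split=> ?; [apply/Heq|apply/Heq|apply/Hrel|apply/Hrel].
Qed.

Lemma agree_trans L (M N P : struc L) V (e1 : V -> M) (e2 : V -> N) (e3 : V -> P) :
  agree e1 e2 -> agree e2 e3 -> agree e1 e3.
Proof.
move=> [E1 R1] [E2 R2]; split=> [u v|r w]; first exact: iff_trans (E1 u v) (E2 u v).
exact: iff_trans (R1 r w) (R2 r w).
Qed.

Lemma agree_comp L (M N : struc L) V W (s : W -> V) (e1 : V -> M) (e2 : V -> N) :
  agree e1 e2 -> agree (e1 \o s) (e2 \o s).
Proof. by case=> Heq Hrel; split=> [u v|r w]; [exact: Heq|exact: (Hrel r (s \o w))]. Qed.

Lemma embedding_agree L (M N : struc L) (h : M -> N) :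
  embedding h <-> agree (@id M) h.
Proof.
split=> -[Hi Hr]; split=> // u v; last by move/Hi.
by split=> [->//|/Hi].
Qed.

Lemma oapp_omap (U V W : Type) (s : U -> V) (e : V -> W) a :
  oapp e a \o omap s = oapp (e \o s) a.
Proof. by apply: funext; case. Qed.

Lemma sat_fmap L (M : struc L) V W (s : W -> V) (e : V -> M) (f : form L W) :
  sat e (fmap s f) <-> sat (e \o s) f.
Proof.
elim: f V s e => //= {W}.
- by move=> W g Hg h Hh V s e; rewrite Hg Hh.
- by move=> W g Hg h Hh V s e; rewrite Hg Hh.
- by move=> W g Hg h Hh V s e; rewrite Hg Hh.
- move=> W g Hg V s e; split=> H a; move: (H a).
    by move/Hg; rewrite -[X in sat X _]/(oapp e a \o omap s) oapp_omap.
  by move=> Ha; apply/Hg; rewrite -[X in sat X _]/(oapp e a \o omap s) oapp_omap.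
- move=> W g Hg V s e; split=> -[a Ha]; exists a.
    by move: Ha => /Hg; rewrite -[X in sat X _]/(oapp e a \o omap s) oapp_omap.
  by apply/Hg; rewrite -[X in sat X _]/(oapp e a \o omap s) oapp_omap.
Qed.

Lemma elementary_iff L (M N : struc L) (h : M -> N) (f : form L M) :
  elementary h -> (sat id f <-> sat h f).
Proof.
move=> Hh; split; first exact: Hh.
move=> Hf; apply: contrapT => Hn.
by have /= := Hh (Not f) Hn; apply.
Qed.

Lemma elementary_models L (M N : struc L) (h : M -> N) (T : theory L) :
  elementary h -> models M T -> models N T.
Proof.
move=> Hh HM s /HM Hs; have -> : of_void N = h \o of_void M by apply: funext; case.
apply/sat_fmap/Hh/sat_fmap.
by have -> : id \o of_void M = of_void M by apply: funext; case.
Qed.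

Lemma fv_in_sub L V (P Q : set V) (f : form L V) :
  P `<=` Q -> fv_in P f -> fv_in Q f.
Proof.
elim: f P Q => //= {V}.
- by move=> V x y P Q PQ [/PQ ? /PQ ?].
- by move=> V r v P Q PQ H i; exact/PQ/H.
- by move=> V g Hg h Hh P Q PQ [/(Hg _ _ PQ) ? /(Hh _ _ PQ) ?].
- by move=> V g Hg h Hh P Q PQ [/(Hg _ _ PQ) ? /(Hh _ _ PQ) ?].
- by move=> V g Hg h Hh P Q PQ [/(Hg _ _ PQ) ? /(Hh _ _ PQ) ?].
- by move=> V g Hg P Q PQ; apply: Hg => -[v|//]; exact: PQ.
- by move=> V g Hg P Q PQ; apply: Hg => -[v|//]; exact: PQ.
Qed.

(** A variable set of [n] elements chosen so that [Vn n.+1] is convertible to [option (Vn n)]: a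
    quantifier binds its variable without any renaming. *)
Fixpoint Vn (n : nat) : finType :=
  if n is m.+1 then option (Vn m) else void.

Fixpoint lookup V (l : seq V) : Vn (size l) -> V :=
  if l is a :: l' then oapp (lookup (l := l')) a else of_void V.

Definition occurs V (l : seq V) : set V := fun v => List.In v l.

Lemma lookup_range V (l : seq V) : occurs l `<=` range (lookup (l := l)).
Proof.
elim: l => //= a l IH v [<-|/IH [i _ <-]]; first by exists None.
by exists (Some i).
Qed.

Lemma fv_in_finite L V (f : form L V) : exists n (s : Vn n -> V), fv_in (range s) f.
Proof.
suff [l Hl] : exists l : seq V, fv_in (occurs l) f.
  by exists (size l), (lookup (l := l)); apply: fv_in_sub Hl; exact: lookup_range.
have bin W (g h : form L W) : (exists l : seq W, fv_in (occurs l) g) ->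
    (exists l : seq W, fv_in (occurs l) h) ->
    exists l : seq W, fv_in (occurs l) g /\ fv_in (occurs l) h.
  move=> [l Hl] [l' Hl']; exists (l ++ l'); split; [apply: fv_in_sub Hl|apply: fv_in_sub Hl'];
    by move=> x Hx; apply/List.in_or_app; auto.
have qua W (g : form L (option W)) : (exists l, fv_in (occurs l) g) ->
    exists l : seq W, fv_in (fun o => if o is Some v then occurs l v else True) g.
  (* [pmap id] drops the bound variable [None] from the list. *)
  move=> [l Hl]; exists (pmap id l); apply: fv_in_sub Hl => -[v|//].
  rewrite /occurs; elim: l => //= a l IH [->|/IH H]; first by left.
  by case: a => [a|] //=; right.
elim: f => //= {V}; eauto.
- by move=> V; exists [::].
- by move=> V x y; exists [:: x; y] => /=; auto.
- move=> V r v; exists [seq v i | i <- enum 'I_(arity r)] => i.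
  have : i \in enum 'I_(arity r) by rewrite mem_enum.
  elim: (enum _) => //= a l IH; rewrite inE => /orP [/eqP ->|/IH]; auto.
Qed.

(** The extension property of generic structures. Only finite tuples are extended, so over a finite
    relational language it is expressed by first-order sentences. *)
Definition one_point_closed L (T0 : theory L) (M : struc L) :=
  forall n (e : Vn n -> M) (N : struc L) (e0 : Vn n -> N) (y : N),
    models N T0 -> agree e e0 -> exists t, agree (oapp e t) (oapp e0 y).

(** Back-and-forth by induction on [f]. The tuples may be infinite, so they are first cut down to a
    finite tuple [s] of variables covering the free ones; each quantifier then lengthens [s] by one
    point, supplied on the other side by the extension property. *)
Lemma agree_sat L (T0 : theory L) (M N : struc L) V (e1 : V -> M) (e2 : V -> N)
    (f : form L V) :
  models M T0 -> models N T0 -> one_point_closed T0 M -> one_point_closed T0 N ->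
  agree e1 e2 -> sat e1 f <-> sat e2 f.
Proof.
move=> HM HN CM CN Hag; have [n [s Hs]] := fv_in_finite f.
have {}Hag : agree (e1 \o s) (e2 \o s) by exact: agree_comp.
have upd W m (t : Vn m -> W) : (fun o : option W => if o is Some v then range t v else True)
    `<=` range (omap t : Vn m.+1 -> option W).
  by case=> [v [i _ <-]|_]; [exists (Some i)|exists None].
elim: f n s e1 e2 Hs Hag => //= {V}.
- move=> V x y n s e1 e2 [[i _ <-] [j _ <-]] [H _]; exact: H.
- move=> V r v n s e1 e2 Hv [_ H].
  have /choice [w Hw] : forall i, exists j, s j = v i by move=> i; have [j] := Hv i; exists j.
  have -> : v = s \o w by apply: funext => i; rewrite /= Hw.
  exact: (H r w).
- by move=> V g Hg h Hh n s e1 e2 [Hsg Hsh] H; move: (Hg _ _ _ _ Hsg H) (Hh _ _ _ _ Hsh H); tauto.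
- by move=> V g Hg h Hh n s e1 e2 [Hsg Hsh] H; move: (Hg _ _ _ _ Hsg H) (Hh _ _ _ _ Hsh H); tauto.
- by move=> V g Hg h Hh n s e1 e2 [Hsg Hsh] H; move: (Hg _ _ _ _ Hsg H) (Hh _ _ _ _ Hsh H); tauto.
- move=> V g Hg n s e1 e2 Hs H.
  have ext a b : agree (oapp (e1 \o s) a) (oapp (e2 \o s) b) ->
      sat (oapp e1 a) g <-> sat (oapp e2 b) g.
    move=> Hab; apply: (Hg n.+1 (omap s)); first exact: fv_in_sub (@upd _ _ _) Hs.
    by rewrite !oapp_omap.
  split=> HA.
    move=> b; have [a /ext Ha] := CM _ _ _ _ b HN H; exact/Ha/HA.
  move=> a; have [b /agree_sym/ext Hb] := CN _ _ _ _ a HM (agree_sym H); exact/Hb/HA.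
- move=> V g Hg n s e1 e2 Hs H.
  have ext a b : agree (oapp (e1 \o s) a) (oapp (e2 \o s) b) ->
      sat (oapp e1 a) g <-> sat (oapp e2 b) g.
    move=> Hab; apply: (Hg n.+1 (omap s)); first exact: fv_in_sub (@upd _ _ _) Hs.
    by rewrite !oapp_omap.
  split=> -[a HA].
    have [b /agree_sym/ext Hb] := CN _ _ _ _ a HM (agree_sym H); exists b; exact/Hb/HA.
  have [b /ext Hb] := CM _ _ _ _ a HN H; exists b; exact/Hb/HA.
Qed.

Fixpoint close L n : form L (Vn n) -> form L void :=
  if n is m.+1 then fun f => close (All f) else id.

Lemma sat_close L (M : struc L) n (f : form L (Vn n)) :
  sat (of_void M) (close f) <-> forall e : Vn n -> M, sat e f.
Proof.
elim: n f => [|n IH] f /=.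
  split=> [H e|]; last exact.
  by have -> : e = of_void M by apply: funext; case.
rewrite IH; split=> H e; last by move=> a; exact: H.
move: (H (e \o Some) (e None)) => /=.
by congr (sat _ _); apply: funext; case.
Qed.

(** * Axioms of the model completion *)

Section Relations.
Variable M : struc L3.
Implicit Types x y : M.
Definition p0 x := @interp L3 M P0 (fun=> x).
Definition p1 x := @interp L3 M P1 (fun=> x).
Definition p2 x := @interp L3 M P2 (fun=> x).
Definition r01 x y := @interp L3 M R01 (pair_fun x y).
Definition r02 x y := @interp L3 M R02 (pair_fun x y).
Definition r12 x y := @interp L3 M R12 (pair_fun x y).
End Relations.

Definition struc3 (C : Type) (q0 q1 q2 : C -> Prop) (q01 q02 q12 : C -> C -> Prop)
    (c : inhabited C) : struc L3 :=
  @Struc L3 C (fun r => match r return ('I_(@arity L3 r) -> C) -> Prop with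
    | P0 => fun v => q0 (v ord0)
    | P1 => fun v => q1 (v ord0)
    | P2 => fun v => q2 (v ord0)
    | R01 => fun v => q01 (v ord0) (v ord_max)
    | R02 => fun v => q02 (v ord0) (v ord_max)
    | R12 => fun v => q12 (v ord0) (v ord_max)
    end) c.

Lemma comp_pair_fun V W (s : V -> W) x y : s \o pair_fun x y = pair_fun (s x) (s y).
Proof. by apply: funext => i; rewrite /pair_fun /=; case: ifP. Qed.

Section SatAtoms.
Variables (M : struc L3) (V : Type) (e : V -> M).
Implicit Types x y : V.
Lemma sat_R01 x y : sat e (fR01 x y) <-> r01 (e x) (e y).
Proof. by rewrite /= comp_pair_fun. Qed.
Lemma sat_R02 x y : sat e (fR02 x y) <-> r02 (e x) (e y).
Proof. by rewrite /= comp_pair_fun. Qed.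
Lemma sat_R12 x y : sat e (fR12 x y) <-> r12 (e x) (e y).
Proof. by rewrite /= comp_pair_fun. Qed.
End SatAtoms.

Record Tforall_model (M : struc L3) : Prop := TforallModel {
  disj01 : forall x : M, p0 x -> p1 x -> False;
  disj02 : forall x : M, p0 x -> p2 x -> False;
  disj12 : forall x : M, p1 x -> p2 x -> False;
  some_sort : forall x : M, p0 x \/ p1 x \/ p2 x;
  r01_sorts : forall x y : M, r01 x y -> p0 x /\ p1 y;
  r02_sorts : forall x y : M, r02 x y -> p0 x /\ p2 y;
  r12_sorts : forall x y : M, r12 x y -> p1 x /\ p2 y;
  r_comp : forall x b c : M, r01 x b -> r12 b c -> r02 x c }.

Lemma models_Tforall (M : struc L3) : models M Tforall <-> Tforall_model M.
Proof.
split=> [H|H s].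
  split.
  - by move=> x H0 H1; apply: (H _ T_disj01 x).
  - by move=> x H0 H1; apply: (H _ T_disj02 x).
  - by move=> x H0 H1; apply: (H _ T_disj12 x).
  - by move=> x; apply: (H _ T_cover x).
  - by move=> x y; have := H _ T_R01 x y; rewrite /= comp_pair_fun.
  - by move=> x y; have := H _ T_R02 x y; rewrite /= comp_pair_fun.
  - by move=> x y; have := H _ T_R12 x y; rewrite /= comp_pair_fun.
  - move=> x b c; have := H _ T_triangle b c; rewrite /= comp_pair_fun => + H1 H2.
    by move=> /(_ H2 x); rewrite !comp_pair_fun; apply.
case: H => H1 H2 H3 H4 H5 H6 H7 H8; case => /=; rewrite ?comp_pair_fun //.
- by move=> x []; apply: H1.
- by move=> x []; apply: H2.
- by move=> x []; apply: H3.
- by move=> x y; rewrite comp_pair_fun; apply: H5.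
- by move=> x y; rewrite comp_pair_fun; apply: H6.
- by move=> x y; rewrite comp_pair_fun; apply: H7.
- by move=> b c; rewrite comp_pair_fun => H x; rewrite !comp_pair_fun => ?; apply: H8 H.
Qed.

Lemma fun1E V (v : 'I_1 -> V) : v = fun=> v ord0.
Proof. by apply: funext => i; rewrite (ord1 i). Qed.

Lemma fun2E V (v : 'I_2 -> V) : v = pair_fun (v ord0) (v ord_max).
Proof.
apply: funext => i; rewrite /pair_fun; case: eqP => [->//|H]; congr v.
by apply: val_inj; case: i H => [[|[|]]] //= Hi H; case: H; apply: val_inj.
Qed.

Section AgreeL3.
Variables (M N : struc L3) (V : Type) (e1 : V -> M) (e2 : V -> N).

Lemma agreeP :
  agree e1 e2 <->
  [/\ forall u v, e1 u = e1 v <-> e2 u = e2 v,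
      forall u, [/\ p0 (e1 u) <-> p0 (e2 u), p1 (e1 u) <-> p1 (e2 u)
                  & p2 (e1 u) <-> p2 (e2 u)]
    & forall u v, [/\ r01 (e1 u) (e1 v) <-> r01 (e2 u) (e2 v),
                      r02 (e1 u) (e1 v) <-> r02 (e2 u) (e2 v)
                    & r12 (e1 u) (e1 v) <-> r12 (e2 u) (e2 v)]].
Proof.
split=> [[Heq H]|[Heq H1 H2]]; split=> //.
- move=> u; split; [exact: (H P0 (fun=> u))|exact: (H P1 (fun=> u))|exact: (H P2 (fun=> u))].
- move=> u v; rewrite /r01 /r02 /r12 -!comp_pair_fun.
  by split; [exact: (H R01)|exact: (H R02)|exact: (H R12)].
case=> /= w.
- by rewrite (fun1E w); case: (H1 (w ord0)).
- by rewrite (fun1E w); case: (H1 (w ord0)).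
- by rewrite (fun1E w); case: (H1 (w ord0)).
- by rewrite (fun2E w) !comp_pair_fun; case: (H2 (w ord0) (w ord_max)).
- by rewrite (fun2E w) !comp_pair_fun; case: (H2 (w ord0) (w ord_max)).
- by rewrite (fun2E w) !comp_pair_fun; case: (H2 (w ord0) (w ord_max)).
Qed.

(** No symbol has arity above 2, so these atoms, taken over all ordered pairs of variables,
    determine the atomic type; the sort of [y] is recorded by the pairs starting with [y]. *)
Definition pair_atoms U (x y : U) : seq (form L3 U) :=
  [:: Eq L3 x y; fP0 x; fP1 x; fP2 x; fR01 x y; fR02 x y; fR12 x y].

Lemma agree_atoms :
  agree e1 e2 <->
  forall u v, all (fun f => `[<sat e1 f <-> sat e2 f>]) (pair_atoms u v).
Proof.
rewrite agreeP; split=> [[H1 H2 H3] u v|H].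
  case: (H2 u) (H3 u v) => ? ? ? [? ? ?].
  rewrite /= !comp_pair_fun.
  by do 7 (apply/andP; split; first exact/asboolP).
split=> u; [move=> v|split|move=> v; split];
  [have := H u v|have := H u u|have := H u u|have := H u u|have := H u v|have := H u v
  |have := H u v];
  by rewrite /= !comp_pair_fun => /and5P [/asboolP ? /asboolP ? /asboolP ? /asboolP ?];
     case/and4P => /asboolP ? /asboolP ? /asboolP ? _.
Qed.

End AgreeL3.

Definition conj_all L V (s : seq (form L V)) : form L V := foldr (@And L V) (Not Bot) s.

Lemma sat_conj_all L (M : struc L) V (e : V -> M) (s : seq (form L V)) :
  sat e (conj_all s) <-> all (fun f => `[<sat e f>]) s.
Proof.
elim: s => [|f s IH] /=; first by split.
by rewrite IH; split=> [[/asboolP -> ->]|/andP [/asboolP]].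
Qed.

(** The atomic type of a finite tuple as a single formula, which exists because both the language
    and [V] are finite. *)
Definition diagram (M : struc L3) (V : finType) (e : V -> M) : form L3 V :=
  conj_all [seq if `[<sat e f>] then f else Not f
           | f <- flatten [seq pair_atoms p.1 p.2 | p <- enum {: V * V}]].

Lemma sat_diagram (M N : struc L3) (V : finType) (e : V -> M) (e' : V -> N) :
  sat e' (diagram e) <-> agree e' e.
Proof.
rewrite sat_conj_all all_map agree_atoms.
set P := fun f => `[<sat e' f <-> sat e f>].
rewrite (eq_all (a2 := P)); last first.
  move=> f /=; rewrite /P; apply/asbool_equiv_eq.
  by case: asboolP => /= H; tauto.
split=> [H u v|H].
  move: pair_atoms H => atoms H.
  elim: (enum _) (mem_enum {: V * V} (u, v)) H => //= p l IH; rewrite inE all_cat.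
  by case: eqP => [<- _ /andP []|_ /= /IH H /andP [_ /H]].
move: pair_atoms H => atoms H.
by elim: (enum _) => //= p l IH; rewrite all_cat; apply/andP; split.
Qed.

(** The extension axioms run over all one-point extensions of finite tuples found inside models of
    [Tforall], so that jointly they say [one_point_closed Tforall]. *)
Inductive Tgen : theory L3 :=
| Tgen_univ s : Tforall s -> Tgen s
| Tgen_ext n (N : struc L3) (e : Vn n -> N) (y : N) : models N Tforall ->
    Tgen (close (Imp (diagram e) (Ex (diagram (V := Vn n.+1) (oapp e y))))).

Lemma models_Tgen (M : struc L3) :
  models M Tgen <-> models M Tforall /\ one_point_closed Tforall M.
Proof.
split=> [H|[HM HC] s [{}s /HM//|n N e y HN]].
  split=> [s Hs|n e N e0 y HN Hag]; first by apply: H; left.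
  have /sat_close /(_ e) /= := H _ (Tgen_ext e0 y HN).
  by move=> /(_ (proj2 (sat_diagram _ _) Hag)) [t /(sat_diagram (V := Vn n.+1)) Ht]; exists t.
apply/sat_close => e0 /= /sat_diagram He.
have [t Ht] := HC _ _ _ _ y HN He; exists t; exact/(sat_diagram (V := Vn n.+1)).
Qed.

(** * Free extensions *)

(** The sort of the new point and its relations to old points suffice: disjointness of the sorts
    forbids any relation of a point to itself. *)
Lemma agree_oapp (M N : struc L3) V (e : V -> M) (e0 : V -> N) (t : M) (y : N) :
  Tforall_model M -> Tforall_model N -> agree e e0 ->
  (forall v, e v <> t) -> (forall v, e0 v <> y) ->
  [/\ p0 t <-> p0 y, p1 t <-> p1 y & p2 t <-> p2 y] ->
  (forall v, [/\ r01 t (e v) <-> r01 y (e0 v), r02 t (e v) <-> r02 y (e0 v)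
               & r12 t (e v) <-> r12 y (e0 v)]) ->
  (forall v, [/\ r01 (e v) t <-> r01 (e0 v) y, r02 (e v) t <-> r02 (e0 v) y
               & r12 (e v) t <-> r12 (e0 v) y]) ->
  agree (oapp e t) (oapp e0 y).
Proof.
move=> HM HN /agreeP [He Hp Hr] Ht Hy Hty Hl Hr'; apply/agreeP; split.
- case=> [u|] [v|] //=; split=> // H;
  first [by case: (Ht u)|by case: (Hy u)|by case: (Ht v)|by case: (Hy v)].
- by case=> [u|] //=.
- case=> [u|] [v|] //=.
  have self (K : struc L3) (z : K) : Tforall_model K -> [/\ ~ r01 z z, ~ r02 z z & ~ r12 z z].
    move=> HK; split.
    + by case/(r01_sorts HK) => /(disj01 HK).
    + by case/(r02_sorts HK) => /(disj02 HK).
    + by case/(r12_sorts HK) => /(disj12 HK).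
  by have [? ? ?] := self _ t HM; have [? ? ?] := self _ y HN; split; tauto.
Qed.

Inductive sort3 := S0 | S1 | S2.

Section FreeModel.
Variable M : struc L3.
Hypothesis HM : Tforall_model M.

(* [New s e q1 q2] is a new element of sort [s], with parameters [e]; [q1] and [q2] mark the
   parameters of the first and of the second of the other two sorts it is related to. *)
Inductive term :=
| Base of M
| New (s : sort3) n (e : Vn n -> term) of pred (Vn n) & pred (Vn n).

(** The age of a term. A new element has larger rank than its parameters, so prescribed neighbours
    are always older; this rules out circular configurations below. *)
Fixpoint rank t :=
  if t is New _ n e _ _ then (\sum_(v : Vn n) rank (e v)).+1 else 0.

Lemma rank_param s n (e : Vn n -> term) q q' v : (rank (e v) < rank (New s e q q'))%N.
Proof. by rewrite /= ltnS (bigD1 v) //= leq_addr. Qed.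

Definition tsort (q : M -> Prop) s t :=
  match t with Base m => q m | New s' _ _ _ _ => s' = s end.

Definition fst_nbr t a :=
  if t is New _ n e q _ then exists v, q v /\ e v = a else False.

Definition snd_nbr t a :=
  if t is New _ n e _ q then exists v, q v /\ e v = a else False.

Lemma rank_fst t a : fst_nbr t a -> (rank a < rank t)%N.
Proof. by case: t => //= s n e q q' [v [_ <-]]; exact: (rank_param s). Qed.

Lemma rank_snd t a : snd_nbr t a -> (rank a < rank t)%N.
Proof. by case: t => //= s n e q q' [v [_ <-]]; exact: (rank_param s). Qed.

Definition base2 (q : M -> M -> Prop) t t' :=
  match t, t' with Base m, Base m' => q m m' | _, _ => False end.

Local Notation t0 := (tsort (@p0 M) S0).
Local Notation t1 := (tsort (@p1 M) S1).
Local Notation t2 := (tsort (@p2 M) S2).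

(** A prescribed relation is stored in the newer of the two elements. For sorts 1 and 2 alike, the
    other one of these two sorts comes second after sort 0, hence [snd_nbr] on both sides. *)
Definition e12 b c :=
  [/\ t1 b, t2 c & [\/ base2 (@r12 M) b c, snd_nbr b c | snd_nbr c b]].

(* The relation between [x] of sort 0 and a newer [b] of sort 1 is discarded when it would
   force an [e02] that does not hold already. *)
Inductive e02 : term -> term -> Prop :=
| e02_base x c : r02 x c -> e02 (Base x) (Base c)
| e02_new x c : t0 x -> t2 c -> snd_nbr x c \/ fst_nbr c x -> e02 x c
| e02_comp_old x b c : t0 x -> t1 b -> base2 (@r01 M) x b \/ fst_nbr x b -> e12 b c -> e02 x c
| e02_comp_new x b c : t0 x -> t1 b -> fst_nbr b x ->
    (forall c', snd_nbr b c' -> t2 c' -> e02 x c') -> e12 b c -> e02 x c.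

(** The last case depends on [e02], which is why the composition constructors of [e02] spell out the
    cases of [e01] instead of mentioning it. *)
Definition e01 x b :=
  [/\ t0 x, t1 b & [\/ base2 (@r01 M) x b, fst_nbr x b
    | fst_nbr b x /\ forall c, snd_nbr b c -> t2 c -> e02 x c]].

Definition free_model : struc L3 :=
  @struc3 term t0 t1 t2 e01 e02 e12
    (let: inhabits m := carrier_nonempty M in inhabits (Base m)).

Lemma e02_sorts x c : e02 x c -> t0 x /\ t2 c.
Proof.
by elim=> [{}x {}c /(r02_sorts HM)||{}x b {}c ? _ _ []|{}x b {}c ? _ _ _ _ []].
Qed.

Lemma e01_comp x b c : e01 x b -> e12 b c -> e02 x c.
Proof.
case=> Hx Hb [H|H|[H H']] Hbc.
- by apply: e02_comp_old Hbc => //; left.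
- by apply: e02_comp_old Hbc => //; right.
- exact: e02_comp_new Hbc.
Qed.

Lemma free_model_Tforall : Tforall_model free_model.
Proof.
split; rewrite /p0 /p1 /p2 /r01 /r02 /r12 /=.
- by case=> [m|s ? ? ? ?] /=; [apply: (disj01 HM)|move=> ->].
- by case=> [m|s ? ? ? ?] /=; [apply: (disj02 HM)|move=> ->].
- by case=> [m|s ? ? ? ?] /=; [apply: (disj12 HM)|move=> ->].
- by case=> [m|s ? ? ? ?] /=; [exact: (some_sort HM m)|case: s; auto].
- by move=> x y [].
- exact: e02_sorts.
- by move=> x y [].
- exact: e01_comp.
Qed.

(** Induction on the derivation. A composition through an old [b] takes place in [M], where [r_comp]
    applies. If [b] is new, then [c] is one of its prescribed neighbours, and the side condition of
    [e02_comp_new] contains a smaller derivation for the same pair. *)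
Lemma e02_Base x c : e02 (Base x) (Base c) -> r02 x c.
Proof.
suff gen t t' : e02 t t' -> forall x c, t = Base x -> t' = Base c -> r02 x c.
  by move/gen; apply.
elim=> {x c t t'}.
- by move=> x c ? x' c' [<-] [<-].
- by move=> x c _ _ [] + x' c' ? ?; subst.
- move=> x b c _ _ Hb [_ _ Hc] x' c' ? ?; subst.
  case: b Hb Hc => [b|? ? ? ? ?] [] //= Hb [] // Hc.
  exact: (r_comp HM) Hb Hc.
- move=> x b c _ _ Hb _ IH [_ Hs Hc] x' c' ? ?; subst.
  by case: Hc => // Hc; [case: b Hb Hc {IH}|exact: (IH _ Hc Hs)].
Qed.

Lemma Base_embedding : @embedding L3 M free_model Base.
Proof.
apply/embedding_agree/agreeP; split=> [u v||u v]; first by split=> [->//|[]].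
  by split.
rewrite /p0 /p1 /p2 /r01 /r02 /r12 /=; split.
- by split=> [H|[_ _ []//=]]; [case: (r01_sorts HM H) => *; split=> //; constructor 1|case].
- by split=> [|/e02_Base//]; exact: e02_base.
- by split=> [H|[_ _ []//=]]; case: (r12_sorts HM H) => *; split=> //; constructor 1.
Qed.

Section NewElement.
Variables (n : nat) (e : Vn n -> term) (N : struc L3) (e0 : Vn n -> N) (y : N).
Hypotheses (HN : Tforall_model N) (He : @agree L3 free_model N _ e e0).

Let agree_eq u v : e u = e v -> e0 u = e0 v.
Proof. by case/agreeP: He => H _ _ /H. Qed.
Let agree0 u : t0 (e u) <-> p0 (e0 u).
Proof. by case/agreeP: He => _ /(_ u) []. Qed.
Let agree1 u : t1 (e u) <-> p1 (e0 u).
Proof. by case/agreeP: He => _ /(_ u) []. Qed.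
Let agree2 u : t2 (e u) <-> p2 (e0 u).
Proof. by case/agreeP: He => _ /(_ u) []. Qed.
Let agree01 u v : e01 (e u) (e v) <-> r01 (e0 u) (e0 v).
Proof. by case/agreeP: He => _ _ /(_ u v) []. Qed.
Let agree02 u v : e02 (e u) (e v) <-> r02 (e0 u) (e0 v).
Proof. by case/agreeP: He => _ _ /(_ u v) []. Qed.
Let agree12 u v : e12 (e u) (e v) <-> r12 (e0 u) (e0 v).
Proof. by case/agreeP: He => _ _ /(_ u v) []. Qed.

Section Sort0.
Let t := New S0 e (fun v => `[<r01 y (e0 v)>]) (fun v => `[<r02 y (e0 v)>]).

Let t_fst w : fst_nbr t (e w) -> r01 y (e0 w).
Proof. by case=> v [/asboolP H /agree_eq <-]. Qed.

Let nlt w : ~ (rank t < rank (e w))%N.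
Proof. by apply/negP; rewrite -leqNgt ltnW //; exact: rank_param. Qed.

Lemma new0_01 w : p0 y -> e01 t (e w) <-> r01 y (e0 w).
Proof.
move=> Hy; split=> [[_ _ [//|/t_fst//|[/rank_fst/nlt//]]]|H].
case: (r01_sorts HN H) => _ /agree1 ?; split=> //; constructor 2.
by exists w; split=> //; exact/asboolP.
Qed.

(** No unwanted relation arises by composition. If the middle point is a parameter of [t],
    composition in [N] gives the relation. If it is newer than [t], then [e w] must be one of its
    prescribed neighbours, by rank, and the side condition leads to a smaller derivation. *)
Lemma new0_02 w : p0 y -> e02 t (e w) <-> r02 y (e0 w).
Proof.
move=> Hy; split=> [H|H]; last first.
  case: (r02_sorts HN H) => _ /agree2 ?; apply: e02_new => //; left.
  by exists w; split=> //; exact/asboolP.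
suff gen x c : e02 x c -> forall w, x = t -> c = e w -> r02 y (e0 w) by exact: gen H _ _ _.
elim=> {x c H w}.
- by [].
- move=> x c _ _ + w Ex Ec; subst => -[|/rank_fst/nlt//].
  by case=> v [/asboolP H /agree_eq <-].
- move=> x b c _ _ Hb Hc w Ex Ec; subst; case: Hb => // -[v [/asboolP Hv Ev]]; subst.
  by apply: (r_comp HN) Hv _; exact/agree12.
- move=> x b c _ _ /rank_fst Hb _ IH [_ Hs Hc] w Ex Ec; subst.
  case: Hc => [|Hc|/rank_snd Hc]; [by case: b Hb {IH}|exact: (IH _ Hc)|].
  by case: (@nlt w); exact: ltn_trans Hb Hc.
Qed.

End Sort0.

Section Sort1.
Let t := New S1 e (fun v => `[<r01 (e0 v) y>]) (fun v => `[<r12 y (e0 v)>]).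

Let nlt w : ~ (rank t < rank (e w))%N.
Proof. by apply/negP; rewrite -leqNgt ltnW //; exact: rank_param. Qed.

(** No prescribed relation is discarded: the side condition in [e01] asks for relations [e02] that
    already hold between the parameters, by composition through [y] in [N]. *)
Lemma new1_01 w : p1 y -> e01 (e w) t <-> r01 (e0 w) y.
Proof.
move=> Hy; split=> [[_ _ [|/rank_fst/nlt//|[]]]|H]; first by case: (e w).
  by case=> v [/asboolP H /agree_eq <-].
case: (r01_sorts HN H) => /agree0 ? _; split=> //; constructor 3; split.
  by exists w; split=> //; exact/asboolP.
move=> c [v [/asboolP Hv <-]] _; apply/agree02; exact: (r_comp HN) H Hv.
Qed.

Lemma new1_12 w : p1 y -> e12 t (e w) <-> r12 y (e0 w).
Proof.
move=> Hy; split=> [[_ _ [//||/rank_snd/nlt//]]|H].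
  by case=> v [/asboolP H /agree_eq <-].
case: (r12_sorts HN H) => _ /agree2 ?; split=> //; constructor 2.
by exists w; split=> //; exact/asboolP.
Qed.

End Sort1.

Section Sort2.
Let t := New S2 e (fun v => `[<r02 (e0 v) y>]) (fun v => `[<r12 (e0 v) y>]).

Let nlt w : ~ (rank t < rank (e w))%N.
Proof. by apply/negP; rewrite -leqNgt ltnW //; exact: rank_param. Qed.

Lemma new2_12 w : p2 y -> e12 (e w) t <-> r12 (e0 w) y.
Proof.
move=> Hy; split=> [[_ _ [|/rank_snd/nlt//|]]|H]; first by case: (e w).
  by case=> v [/asboolP H /agree_eq <-].
case: (r12_sorts HN H) => /agree1 ? _; split=> //; constructor 3.
by exists w; split=> //; exact/asboolP.
Qed.

(** As in [new0_02], with the middle point now on the side of [t]: a parameter of [t] is handled by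
    composition in [N], a newer point by the side condition, and a point newer than [t] but older
    than [e w] cannot exist. *)
Lemma new2_02 w : p2 y -> e02 (e w) t <-> r02 (e0 w) y.
Proof.
move=> Hy; split=> [H|H]; last first.
  case: (r02_sorts HN H) => /agree0 ? _; apply: e02_new => //; right.
  by exists w; split=> //; exact/asboolP.
suff gen x c : e02 x c -> forall w, c = t -> x = e w -> r02 (e0 w) y by exact: gen H _ _ _.
elim=> {x c H w}.
- by [].
- move=> x c _ _ + w Ec Ex; subst => -[/rank_snd/nlt//|].
  by case=> v [/asboolP H /agree_eq <-].
- move=> x b c H0 H1 Hb [_ _ Hc] w Ec Ex; subst.
  case: Hc => [|/rank_snd Hc|[v [/asboolP Hv Ev]]]; first by case: b {H1 Hb}.
    case: Hb => [|/rank_fst Hb]; first by case: b Hc {H1} => [|? ? ? ? ?] //; case: (e w).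
    by case: (@nlt w); exact: ltn_trans Hc Hb.
  subst; apply: (r_comp HN) Hv; apply/agree01; split=> //.
  by case: Hb; [constructor 1|constructor 2].
- move=> x b c H0 H1 Hb Hb' IH [_ Hs Hc] w Ec Ex; subst.
  case: Hc => [|Hc|[v [/asboolP Hv Ev]]]; first by case: b Hb {H1 IH Hb'}.
    exact: (IH _ Hc).
  by subst; apply: (r_comp HN) Hv; apply/agree01; split=> //; constructor 3.
Qed.

End Sort2.

End NewElement.

Lemma free_model_closed : one_point_closed Tforall free_model.
Proof.
move=> n e N e0 y /models_Tforall HN He.
(* A point [y] already listed in [e0] is matched by the corresponding parameter; only otherwise is a
   new element taken. *)
have [[v <-]|Hy] := pselect (exists v, e0 v = y).
  exists (e v).
  have E (K : struc L3) (f : Vn n -> K) : oapp f (f v) = f \o odflt v.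
    by apply: funext; case.
  by rewrite !E; exact: agree_comp.
have {}Hy v : e0 v <> y by move=> Hv; apply: Hy; exists v.
have HF := free_model_Tforall.
have Hnew s q q' v : e v <> New s e q q'.
  by move=> H; have := rank_param s e q q' v; rewrite H ltnn.
pose T s (q q' : pred (Vn n)) : free_model := New s e q q'.
have ext s q q' := @agree_oapp free_model N _ e e0 (T s q q') y HF HN He (Hnew _ _ _) Hy.
(* Relations between the wrong sorts fail on both sides, so only those compatible with the sort of
   [y] remain to be compared. *)
have off (K : struc L3) (a b : K) : Tforall_model K ->
    [/\ r01 a b -> p0 a /\ p1 b, r02 a b -> p0 a /\ p2 b & r12 a b -> p1 a /\ p2 b].
  by move=> HK; split; [exact: (r01_sorts HK)|exact: (r02_sorts HK)|exact: (r12_sorts HK)].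
have realized s q q' (t := T s q q') : [/\ s = S0 <-> p0 y, s = S1 <-> p1 y & s = S2 <-> p2 y] ->
    [/\ forall v, p0 y -> r01 t (e v) <-> r01 y (e0 v),
        forall v, p0 y -> r02 t (e v) <-> r02 y (e0 v)
      & forall v, p1 y -> r12 t (e v) <-> r12 y (e0 v)] ->
    [/\ forall v, p1 y -> r01 (e v) t <-> r01 (e0 v) y,
        forall v, p2 y -> r02 (e v) t <-> r02 (e0 v) y
      & forall v, p2 y -> r12 (e v) t <-> r12 (e0 v) y] ->
    exists t : free_model, agree (oapp e t) (oapp e0 y).
  move=> [Y0 Y1 Y2] [L01 L02 L12] [R01 R02 R12]; exists t; apply: ext => [|v|v].
  - by split; [exact: Y0|exact: Y1|exact: Y2].
  - have [? ? ?] := off _ t (e v) HF; have [? ? ?] := off _ y (e0 v) HN.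
    by move: (L01 v) (L02 v) (L12 v); split; tauto.
  - have [? ? ?] := off _ (e v) t HF; have [? ? ?] := off _ (e0 v) y HN.
    by move: (R01 v) (R02 v) (R12 v); split; tauto.
have N01 := disj01 HN (x := y); have N02 := disj02 HN (x := y); have N12 := disj12 HN (x := y).
have [H|[H|H]] := some_sort HN y.
- apply: (realized S0 (fun v => `[<r01 y (e0 v)>]) (fun v => `[<r02 y (e0 v)>])).
  + by split; split=> // K; exfalso; [exact: N01 H K|exact: N02 H K].
  + split=> v; [exact: new0_01|exact: new0_02|by move/(N01 H)].
  + by split=> v; [move/(N01 H)|move/(N02 H)|move/(N02 H)].
- apply: (realized S1 (fun v => `[<r01 (e0 v) y>]) (fun v => `[<r12 y (e0 v)>])).
  + by split; split=> // K; exfalso; [exact: N01 K H|exact: N12 H K].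
  + by split=> v; [move/N01/(_ H)|move/N01/(_ H)|exact: new1_12].
  + by split=> v; [exact: new1_01|move/(N12 H)|move/(N12 H)].
- apply: (realized S2 (fun v => `[<r02 (e0 v) y>]) (fun v => `[<r12 (e0 v) y>])).
  + by split; split=> // K; exfalso; [exact: N02 K H|exact: N12 K H].
  + by split=> v; [move/N02/(_ H)|move/N02/(_ H)|move/N12/(_ H)].
  + by split=> v; [move/N12/(_ H)|exact: new2_02|exact: new2_12].
Qed.

End FreeModel.

Lemma Tgen_model_completion : model_completion Tforall Tgen.
Proof.
split=> [M /models_Tgen []//|M /models_Tforall HM|M _ N1 N2 h1 h2].
  exists (free_model M), (@Base M); split; last exact: Base_embedding.
  apply/models_Tgen; split; first exact/models_Tforall/free_model_Tforall.
  exact: free_model_closed.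
move=> /models_Tgen [T1 C1] /embedding_agree H1 /models_Tgen [T2 C2] /embedding_agree H2 f.
by apply: agree_sat T1 T2 C1 C2 _; exact: agree_trans (agree_sym H1) H2.
Qed.

(** * SOP_3 *)

Lemma Tgen_sat (M N : struc L3) V (e1 : V -> M) (e2 : V -> N) (f : form L3 V) :
  models M Tgen -> models N Tgen -> agree e1 e2 -> sat e1 f <-> sat e2 f.
Proof. by move=> /models_Tgen [T1 C1] /models_Tgen [T2 C2]; exact: (agree_sat f T1 T2 C1 C2). Qed.

Lemma Tgen_extend (M : struc L3) : Tforall_model M ->
  exists (N : struc L3) (h : M -> N), models N Tgen /\ agree id h.
Proof.
move/models_Tforall => HM; have [_ /(_ _ HM) [N [h [HN Hh]]] _] := Tgen_model_completion.
by exists N, h; split=> //; exact/embedding_agree.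
Qed.

Section SOP3.
Let j0 : 'I_3 := ord0.
Let j1 : 'I_3 := Ordinal (isT : 1 < 3)%N.
Let j2 : 'I_3 := ord_max.

(** Around a 3-cycle, the first two edges compose to an [R02] from the first tuple to the third,
    which the negated conjunct of the closing edge forbids. *)
Let psi : form L3 ('I_3 + 'I_3) :=
  And (And (fR01 (inl j0) (inr j1)) (fR12 (inl j1) (inr j2))) (Not (fR02 (inr j0) (inl j2))).

Let sat_psi (M : struc L3) (a b : 'I_3 -> M) :
  sat2 psi a b <-> [/\ r01 (a j0) (b j1), r12 (a j1) (b j2) & ~ r02 (b j0) (a j2)].
Proof.
by rewrite /sat2 /= !comp_pair_fun; split=> [[[]]|[]].
Qed.

Let lt_sorts s s' (x y : nat * sort3) := [/\ x.2 = s, y.2 = s' & (x.1 < y.1)%N].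

(** The composition axiom here is transitivity of [<]. *)
Let chain : struc L3 :=
  @struc3 (nat * sort3) (fun x => x.2 = S0) (fun x => x.2 = S1) (fun x => x.2 = S2)
    (lt_sorts S0 S1) (lt_sorts S0 S2) (lt_sorts S1 S2) (inhabits (0, S0)).

Let chain_Tforall : Tforall_model chain.
Proof.
split; rewrite /p0 /p1 /p2 /r01 /r02 /r12 /= /lt_sorts => -[i s] /=; try by move=> ->.
- by case: s; auto.
- by case=> j s' [].
- by case=> j s' [].
- by case=> j s' [].
- by move=> [j s'] [k s''] /= [-> -> ij] [_ -> jk]; split=> //; exact: ltn_trans jk.
Qed.

Lemma Tgen_SOP3 : SOP 3 Tgen.
Proof.
exists 3, psi; split.
  have [N [h [HN /agreeP [_ _ Hh]]]] := Tgen_extend chain_Tforall.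
  pose a i (t : 'I_3) : chain := (i, nth S0 [:: S0; S1; S2] t).
  exists N, (fun i t => h (a i t)); split=> // i j; rewrite sat_psi.
  have [E01 _ _] := Hh (a i j0) (a j j1); have [_ _ E12] := Hh (a i j1) (a j j2).
  have [_ E02 _] := Hh (a j j0) (a i j2).
  split=> [[/E01 []//]|ij]; split; [exact/E01|exact/E12|].
  by case/E02 => _ _ /=; rewrite ltnNge ltnW.
case=> N [x [/models_Tgen [/models_Tforall HN _] Hx /sat_psi [_ _]]]; apply.
have /sat_psi [H _ _] := Hx 0 isT; have /sat_psi [_ H' _] := Hx 1 isT.
exact: (r_comp HN) H H'.
Qed.
End SOP3.

(** * Ramsey's theorem for triangles *)

(** Otherwise each colour [k] is absent from [A] beyond some bound [b k], and an element of [A] past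
    all the bounds has no colour left. *)
Lemma infinite_pigeonhole (C : finType) (A : set nat) (c : nat -> C) :
  (forall m, exists2 n, (m <= n)%N & A n) ->
  exists k, forall m, exists2 n, (m <= n)%N & A n /\ c n = k.
Proof.
move=> HA; apply: contrapT => Hn.
have /choice [b Hb] : forall k, exists m, forall n, (m <= n)%N -> A n -> c n <> k.
  move=> k; apply: contrapT => Hk; apply: Hn; exists k => m; apply: contrapT => Hm.
  by apply: Hk; exists m => n mn An cn; apply: Hm; exists n.
have [n Hn' An] := HA (\max_k b k).
by apply: (Hb (c n) n) => //; apply: leq_trans Hn'; exact: leq_bigmax.
Qed.

Lemma monochromatic_triangle (C : finType) (c : nat -> nat -> C) :
  exists i j l, [/\ (i < j)%N, (j < l)%N, c i j = c i l & c i j = c j l].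
Proof.
apply: contrapT => Hn.
(* [F] holds the colours already excluded on pairs from the unbounded set [A], and [m] counts the
   remaining ones. A colour [k] joining some [i] to unboundedly many points cannot occur between two
   of these, so passing to them adds [k] to [F]. *)
suff gen m : forall (A : set nat) (F : {set C}), #|~: F| = m ->
    (forall k, exists2 n, (k <= n)%N & A n) ->
    (forall i j, A i -> A j -> (i < j)%N -> c i j \notin F) -> False.
  by apply: (gen _ [set: nat] finset.set0 erefl) => [k|i j _ _ _]; [exists k|rewrite inE].
elim: m => [|m IH] A F HF HA Hc; have [i _ Ai] := HA 0; have [j ij Aj] := HA i.+1.
  by have := Hc i j Ai Aj ij; rewrite -finset.in_setC (cards0_eq HF) inE.
have [k Hk] : exists k, forall m, exists2 n, (m <= n)%N & [/\ A n, (i < n)%N & c i n = k].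
  have [|k Hk] := @infinite_pigeonhole C (fun n => A n /\ (i < n)%N) (c i).
    by move=> p; have [n] := HA (maxn p i.+1); rewrite geq_max => /andP [? ?] ?; exists n.
  by exists k => p; have [n ? [[? ?] ?]] := Hk p; exists n.
have [n _ [An In cn]] := Hk 0; have kF : k \notin F by rewrite -cn Hc.
apply: (IH [set n | [/\ A n, (i < n)%N & c i n = k]] (k |: F)) => //.
  have := cardsC1 k; have := cardsD1 k (~: F).
  by rewrite inE kF HF add1n => -[->] _; apply: eq_card => x; rewrite !inE negb_or.
move=> p q [Ap ip cp] [Aq iq cq] pq; rewrite !inE negb_or Hc // andbT.
by apply/eqP => Ek; apply: Hn; exists i, p, q; rewrite cp cq Ek.
Qed.

(** * NSOP_4 *)

Section FourCycle.
Variables (M : struc L3) (k : nat) (a0 a1 : 'I_k -> M).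
Hypotheses (HM : Tforall_model M) (Ha : agree a0 a1).
Hypothesis Hfix : forall u v, a0 u = a1 v -> a0 u = a1 u /\ a0 v = a1 v.

(** Numbers modulo 4 in binary, low bit second; [next] adds 1. The label [None], for shared
    elements, counts as lying on every edge. *)
Let vertex : eqType := (bool * bool)%type.
Let next (i : vertex) : vertex := (i.1 (+) i.2, ~~ i.2).
Let near i (o : option vertex) := [|| o == None, o == Some i | o == Some (next i)].

(** Three labels that pairwise lie on an edge lie on one common edge, because a 4-cycle contains no
    triangle. *)
Let near_common i j l o o' o'' : near i o -> near i o' -> near j o' -> near j o'' ->
  near l o -> near l o'' -> exists m, [/\ near m o, near m o' & near m o''].
Proof.
move=> i1 i2 j1 j2 l1 l2.
have [Eo|[Eo'|Eo'']] : near i o'' \/ near j o \/ near l o'.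
  move: i1 i2 j1 j2 l1 l2; case: o o' o'' => [o|] [o'|] [o''|]; auto.
  case: i j l o o' o'' => [[] []] [[] []] [[] []]; rewrite /near /= => -[[] []] [[] []] //;
    by [auto|case=> [[] []]; auto].
- by exists i.
- by exists j.
- by exists l.
Qed.

(** Two distinct edges share at most one vertex. *)
Let near_eq i j o o' : i <> j -> near i o -> near i o' -> near j o -> near j o' ->
  [\/ o = None, o' = None | o = o'].
Proof.
case: i => [] [] []; case: j => [] [] []; case: o => [[[] []]|] //; case: o' => [[[] []]|] //= *;
  by [constructor 1|constructor 2|constructor 3].
Qed.

Let shift_ex : exists s : M -> M, forall u, s (a0 u) = a1 u.
Proof.
have /choice [s Hs] : forall m, exists m', forall u, m = a0 u -> m' = a1 u.
  move=> m; have [[u ->]|Hn] := pselect (exists u, m = a0 u).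
    by exists (a1 u) => v; case: Ha => H _ /H.
  by exists m => u Hu; case: Hn; exists u.
by exists s => u; exact: Hs.
Qed.
Let shift := sval (cid shift_ex).
Let shiftE u : shift (a0 u) = a1 u.
Proof. exact: (svalP (cid shift_ex)). Qed.

(* The points of the cycle are the copies [(a0 u, Some i)] of [a0] at the vertices [i] of a
   4-cycle, except that the elements common to [a0] and [a1] are not duplicated.  The chart
   [at_edge i] sends the vertices [i] and [next i] to [a0] and [a1]. *)
Let point := (M * option vertex)%type.
Let valid (s : point) := exists u, s.1 = a0 u /\ (s.2 = None <-> a0 u = a1 u).
Let at_edge i (s : point) := if s.2 == Some (next i) then shift s.1 else s.1.
Let glue (R : M -> M -> Prop) (s t : point) :=
  [/\ valid s, valid t & exists i, [/\ near i s.2, near i t.2 & R (at_edge i s) (at_edge i t)]].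

Let invariant (R : M -> M -> Prop) := forall u v, R (a0 u) (a0 v) <-> R (a1 u) (a1 v).

(** When the two points do not sit at distinct vertices, the chart reads them either both in [a0] or
    both in [a1], a shared element being readable in both; invariance of [R] makes the two readings
    equivalent. *)
Let at_edge_same R i s t u v : invariant R -> [\/ s.2 = None, t.2 = None | s.2 = t.2] ->
  s.1 = a0 u -> (s.2 = None -> a0 u = a1 u) -> t.1 = a0 v -> (t.2 = None -> a0 v = a1 v) ->
  R (at_edge i s) (at_edge i t) <-> R (a0 u) (a0 v).
Proof.
rewrite /at_edge => HR; case: s t => s o [t o'] /= + -> Hu -> Hv; rewrite !shiftE.
case=> Ho; subst.
- rewrite Hu //=; case: ifP => // _; rewrite -Hu // HR; by rewrite -Hu.
- rewrite Hv //=; case: ifP => // _; rewrite -Hv // HR; by rewrite -Hv.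
- by case: ifP => // _; rewrite HR.
Qed.

(** Independence of the chart: if two different edges contain both points, [near_eq] puts the pair
    in the situation of [at_edge_same]. *)
Let glueE R i s t : invariant R -> valid s -> valid t -> near i s.2 -> near i t.2 ->
  glue R s t <-> R (at_edge i s) (at_edge i t).
Proof.
move=> HR Hs Ht is_ it; split=> [[_ _ [j [js jt Hj]]]|H]; last by split=> //; exists i.
have [->//|/eqP ij] := eqVneq i j.
case: Hs Ht => u [Eu Hu] [v [Ev Hv]].
have Hst := near_eq ij is_ it js jt.
apply/(at_edge_same i HR Hst Eu (proj1 Hu) Ev (proj1 Hv)).
exact/(at_edge_same j HR Hst Eu (proj1 Hu) Ev (proj1 Hv)).
Qed.

Let inv01 : invariant (@r01 M).
Proof. by move=> u v; case/agreeP: Ha => _ _ /(_ u v) []. Qed.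
Let inv02 : invariant (@r02 M).
Proof. by move=> u v; case/agreeP: Ha => _ _ /(_ u v) []. Qed.
Let inv12 : invariant (@r12 M).
Proof. by move=> u v; case/agreeP: Ha => _ _ /(_ u v) []. Qed.

(** Composites are added outright, to force the composition axiom. *)
Let cycle02 s t := glue (@r02 M) s t \/ exists b, glue (@r01 M) s b /\ glue (@r12 M) b t.

Definition four_cycle : struc L3 :=
  @struc3 point (fun s => p0 s.1) (fun s => p1 s.1) (fun s => p2 s.1)
    (glue (@r01 M)) cycle02 (glue (@r12 M))
    (let: inhabits m := carrier_nonempty M in inhabits (m, None)).

(** Added composites change nothing along an edge: by [near_common] the middle point lies on one
    edge with both ends, and there the composition axiom of [M] applies. *)
Let cycle02E i s t : valid s -> valid t -> near i s.2 -> near i t.2 ->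
  cycle02 s t <-> r02 (at_edge i s) (at_edge i t).
Proof.
move=> Hs Ht is_ it; split=> [[|[b]]|H]; last by left; apply/(glueE (i := i)).
  by move/(glueE inv02 Hs Ht is_ it).
move=> [sb bt]; have [_ Hb [j [js jb _]]] := sb; have [_ _ [l [lb lt _]]] := bt.
have [m [ms mb mt]] := near_common js jb lb lt is_ it.
apply/(glueE inv02 Hs Ht is_ it)/(glueE inv02 Hs Ht ms mt).
apply: (r_comp HM); first exact/(glueE inv01 Hs Hb ms mb).
exact/(glueE inv12 Hb Ht mb mt).
Qed.

Let at_edge_sort i s : valid s ->
  [/\ p0 (at_edge i s) -> p0 s.1, p1 (at_edge i s) -> p1 s.1 & p2 (at_edge i s) -> p2 s.1].
Proof.
case: s => s o [u [/= -> _]]; rewrite /at_edge /=; case: ifP => // _; rewrite shiftE.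
by case/agreeP: Ha => _ /(_ u) [] H0 H1 H2 _; split=> [/H0|/H1|/H2].
Qed.

Lemma four_cycle_Tforall : Tforall_model four_cycle.
Proof.
have sorts01 s t : glue (@r01 M) s t -> p0 s.1 /\ p1 t.1.
  case=> /at_edge_sort Hs /at_edge_sort Ht [i [_ _ /(r01_sorts HM)]].
  by case: (Hs i) (Ht i) => H _ _ [_ H' _] [/H ? /H'].
have sorts12 s t : glue (@r12 M) s t -> p1 s.1 /\ p2 t.1.
  case=> /at_edge_sort Hs /at_edge_sort Ht [i [_ _ /(r12_sorts HM)]].
  by case: (Hs i) (Ht i) => _ H _ [_ _ H'] [/H ? /H'].
split; rewrite /p0 /p1 /p2 /r01 /r02 /r12 /=.
- by move=> s; exact: (disj01 HM).
- by move=> s; exact: (disj02 HM).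
- by move=> s; exact: (disj12 HM).
- by move=> s; exact: (some_sort HM).
- exact: sorts01.
- move=> s t [|[b [/sorts01 [? _] /sorts12 [_ ?]]]]; last by [].
  case=> /at_edge_sort Hs /at_edge_sort Ht [i [_ _ /(r02_sorts HM)]].
  by case: (Hs i) (Ht i) => H _ _ [_ _ H'] [/H ? /H'].
- exact: sorts12.
- by move=> x b c xb bc; right; exists b.
Qed.

Let vertex_tuple i u : point := (a0 u, if `[<a0 u = a1 u>] then None else Some i).

Let vertex_tuple_valid i u : valid (vertex_tuple i u).
Proof. by exists u; split=> //=; case: asboolP. Qed.

Let next_neq i : (Some i == Some (next i)) = false.
Proof. by case: i => [] [] []. Qed.

Let edge i (w : 'I_k + 'I_k) : point :=
  match w with inl u => vertex_tuple i u | inr u => vertex_tuple (next i) u end.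

Lemma edge_agree i : @agree L3 four_cycle M _ (edge i)
  (fun w => match w with inl u => a0 u | inr u => a1 u end).
Proof.
have Hv w : valid (edge i w) by case: w => u; exact: vertex_tuple_valid.
have Hn w : near i (edge i w).2.
  by case: w => u /=; case: asboolP => // _; rewrite /near /= eqxx ?orbT.
have HE w : at_edge i (edge i w) = match w with inl u => a0 u | inr u => a1 u end.
  case: w => u; rewrite /at_edge /=; case: asboolP => //= _; first by rewrite next_neq.
  by rewrite eqxx shiftE.
case/agreeP: (Ha) => Heq Hp _.
have lvl u v (j : vertex) : a0 u = a0 v -> vertex_tuple j u = vertex_tuple j v.
  by move=> H; have /Heq E := H; rewrite /vertex_tuple /= H E.
apply/agreeP; split.
(* By [Hfix], coordinates that coincide across the edge are shared elements, so both copies carry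
   the label [None]. *)
- have cross u v : vertex_tuple i u = vertex_tuple (next i) v <-> a0 u = a1 v.
    split=> [[-> ]|H].
      case: asboolP => [|_]; case: asboolP => [//|_] //.
      by case => /eqP; rewrite -[_ == _]/(Some _ == Some _) next_neq.
    have [E E'] := Hfix H; rewrite /vertex_tuple (asboolT E) (asboolT E').
    by rewrite H -E'.
  move=> [u|u] [v|v] /=.
  + by split=> [[]//|]; exact: lvl.
  + exact: cross.
  + by split=> /esym/cross/esym.
  + by rewrite -Heq; split=> [[]//|]; exact: lvl.
- by case=> u; case: (Hp u) => ? ? ?; split.
- move=> w w'; rewrite -!HE; split.
  + exact: (glueE inv01 (Hv w) (Hv w') (Hn w) (Hn w')).
  + exact: (cycle02E (Hv w) (Hv w') (Hn w) (Hn w')).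
  + exact: (glueE inv12 (Hv w) (Hv w') (Hn w) (Hn w')).
Qed.

Lemma cycle_sat4 (f : form L3 ('I_k + 'I_k)) : models M Tgen -> sat2 f a0 a1 ->
  exists (N : struc L3) (x : nat -> 'I_k -> N),
    [/\ models N Tgen, forall i, (i < 3)%N -> sat2 f (x i) (x i.+1) & sat2 f (x 3) (x 0)].
Proof.
move=> MT Hf; have [N [h [HN Hh]]] := Tgen_extend four_cycle_Tforall.
pose x i u := h (vertex_tuple (iter i next (false, false)) u).
have Hx i : sat2 f (fun u => h (vertex_tuple i u)) (fun u => h (vertex_tuple (next i) u)).
  apply/(Tgen_sat f HN MT); last exact: Hf.
  apply: agree_trans (edge_agree i); apply: agree_sym.
  rewrite (_ : (fun _ => _) = h \o edge i); last by apply: funext; case.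
  exact: (agree_comp (edge i) Hh).
(* The closing edge is also an instance of [Hx], since four applications of [next] to the starting
   vertex compute back to it. *)
by exists N, x; split=> // [i _|]; exact: Hx.
Qed.

End FourCycle.

Lemma Tgen_NSOP4 : NSOP 4 Tgen.
Proof.
case=> k [f [[M [a [MT Hf]]]]]; apply.
have HM : Tforall_model M by apply/models_Tforall; case/models_Tgen: MT.
pose pair i j (w : 'I_k + 'I_k) := match w with inl u => a i u | inr u => a j u end.
(* The colour is the truth table of all atoms on the pair of tuples, that is, its atomic type. *)
pose color i j : {ffun ('I_k + 'I_k) * ('I_k + 'I_k) -> 7.-tuple bool} :=
  [ffun w => map_tuple (fun g => `[<sat (pair i j) g>]) (in_tuple (pair_atoms w.1 w.2))].
have colorP i j i' j' : color i j = color i' j' -> agree (pair i j) (pair i' j').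
  move=> /ffunP H; apply/agree_atoms => u v; have := congr1 val (H (u, v)).
  rewrite !ffunE /=.
  move=> [*] /=.
  by do 7 (apply/andP; split; first by apply/asboolP; apply: asbool_eq_equiv).
have [i [j [l [ij jl /colorP H /colorP H']]]] := monochromatic_triangle color.
apply: (@cycle_sat4 M k (a i) (a j) HM) => //; last exact/Hf.
  exact: (agree_comp inl H').
have [[H1 _] [H2 _]] := (H, H').
(* An equality [a i u = a j v] transfers to the pairs [(i, l)] and [(j, l)]; both [a i u] and
   [a j u] then equal [a l v], and so does [a j v]. *)
move=> u v uv.
have E1 : a i u = a l v by apply/(H1 (inl u) (inr v)).
have E2 : a j u = a l v by apply/(H2 (inl u) (inr v)).
have E3 : a j v = a l v by rewrite -uv.
by split; [rewrite E1|apply/(H2 (inl v) (inr v))].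
Qed.

(** * Singular compactness *)

Section NewPoint.
Variable M : struc L3.
Hypothesis HM : Tforall_model M.

Definition with_point1 (A C : set M) : struc L3 :=
  @struc3 (option M)
    (fun s => if s is Some x then p0 x else False)
    (fun s => if s is Some x then p1 x else True)
    (fun s => if s is Some x then p2 x else False)
    (fun s t => match s, t with
       Some x, Some y => r01 x y | Some x, None => A x | None, _ => False end)
    (fun s t => if (s, t) is (Some x, Some y) then r02 x y else False)
    (fun s t => match s, t with
       Some x, Some y => r12 x y | None, Some y => C y | _, None => False end)
    (inhabits None).

Lemma with_point1_Tforall (A C : set M) : A `<=` @p0 M -> C `<=` @p2 M ->
  (forall a c, A a -> C c -> r02 a c) -> Tforall_model (with_point1 A C).
Proof.
move=> HA HC HAC; split; rewrite /p0 /p1 /p2 /r01 /r02 /r12 /=.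
- by case=> // x; exact: (disj01 HM).
- by case=> // x; exact: (disj02 HM).
- by case=> // x; exact: (disj12 HM).
- by case=> [x|]; [exact: (some_sort HM)|auto].
- by case=> // x [y|]; [exact: (r01_sorts HM)|move/HA].
- by case=> // x [y|//]; exact: (r02_sorts HM).
- by case=> [x|] [y|] //; [exact: (r12_sorts HM)|move/HC].
- by case=> // x [b|] [c|] //; [exact: (r_comp HM)|exact: HAC].
Qed.

Lemma with_point1_agree (A C : set M) :
  @agree L3 M (with_point1 A C) _ id Some.
Proof. by apply/agreeP; split=> // u v; split=> [->|[]]. Qed.

(** Relating the new point to everything of sorts 1 and 2 satisfies the composition axiom trivially,
    so the formulas [R01(x, b)], for [b] of sort 1, are jointly consistent. *)
Definition with_top0 : struc L3 :=
  @struc3 (option M)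
    (fun s => if s is Some x then p0 x else True)
    (fun s => if s is Some x then p1 x else False)
    (fun s => if s is Some x then p2 x else False)
    (fun s t => match s, t with
       Some x, Some y => r01 x y | None, Some y => p1 y | _, None => False end)
    (fun s t => match s, t with
       Some x, Some y => r02 x y | None, Some y => p2 y | _, None => False end)
    (fun s t => if (s, t) is (Some x, Some y) then r12 x y else False)
    (inhabits None).

Lemma with_top0_Tforall : Tforall_model with_top0.
Proof.
split; rewrite /p0 /p1 /p2 /r01 /r02 /r12 /=.
- by case=> // x; exact: (disj01 HM).
- by case=> // x; exact: (disj02 HM).
- by case=> // x; exact: (disj12 HM).
- by case=> [x|]; [exact: (some_sort HM)|auto].
- by case=> [x|] [y|] //; exact: (r01_sorts HM).
- by case=> [x|] [y|] //; exact: (r02_sorts HM).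
- by case=> // x [y|//]; exact: (r12_sorts HM).
- by case=> [x|] [b|] [c|] //; [exact: (r_comp HM)|move=> _ /(r12_sorts HM) []].
Qed.

Lemma with_top0_agree : @agree L3 M with_top0 _ id Some.
Proof. by apply/agreeP; split=> // u v; split=> [->|[]]. Qed.

End NewPoint.

Lemma finite_set_range T (A : set T) :
  finite_set A -> exists n (e : Vn n -> T), A `<=` range e.
Proof.
move=> /(@finite_seqP {classic T}) [s ->]; exists (size s), (lookup (l := s)) => x xs.
apply: lookup_range; rewrite /occurs; elim: s xs => //= a s IH.
by rewrite /= inE => /orP [/eqP ->|/IH]; auto.
Qed.

(** The extension property is applied to an enumeration of the finite set [A] together with [C], and
    to the extra point of [with_point1 A C]. *)
Lemma finite_bound (M : struc L3) (A C : set M) : models M Tgen ->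
  finite_set A -> finite_set C -> A `<=` @p0 M -> C `<=` @p2 M ->
  (forall a c, A a -> C c -> r02 a c) ->
  exists b : M, (forall a, A a -> r01 a b) /\ (forall c, C c -> r12 b c).
Proof.
move=> /models_Tgen [/models_Tforall HM HC] fA fC HA HC' HAC.
have [n [e He]] : exists n (e : Vn n -> M), A `|` C `<=` range e.
  by apply: finite_set_range; rewrite finite_setU.
have /models_Tforall HN := with_point1_Tforall HM HA HC' HAC.
have [b /agreeP [_ _ Hb]] :=
  HC n e (with_point1 A C) _ None HN (agree_comp e (with_point1_agree A C)).
exists b; split=> [a Aa|c Cc].
  have [i _ Ei] := He a (or_introl Aa); case: (Hb (Some i) None) => /= + _ _.
  by rewrite Ei => -> .
have [i _ Ei] := He c (or_intror Cc); case: (Hb None (Some i)) => /= _ _.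
by rewrite Ei => -> .
Qed.

Lemma sat_inst_phi (M N : struc L3) (e : 'I_1 + M -> N) (c : 'I_1 -> M) :
  sat e (inst phi c) <-> r02 (e (inl ord0)) (e (inr (c ord0))).
Proof. by rewrite /= !comp_pair_fun. Qed.

Lemma sat_inst_theta (M N : struc L3) (e : 'I_1 + M -> N) (c : 'I_1 -> M) :
  sat e (inst theta c) <-> r01 (e (inl ord0)) (e (inr (c ord0))).
Proof. by rewrite /= !comp_pair_fun. Qed.

Lemma delta_type_inst (M : struc L3) (A : set M) (p : pset M 1) g :
  delta_type Delta A p -> p g -> exists2 c, A c & g = inst phi (fun=> c).
Proof.
case=> _ Hp /Hp [f [c [Df Ac ->]]]; rewrite /Delta /= in Df; subst f.
by exists (c ord0); [exact: Ac|rewrite /= {1}(fun1E c)].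
Qed.

Lemma delta_type_sort (M : struc L3) (A : set M) (p : pset M 1) (c : M) :
  Tforall_model M -> delta_type Delta A p -> p (inst phi (fun=> c)) -> p2 c.
Proof.
move=> HM [[N [h [a [Hh Ha]]]] _] /Ha /sat_inst_phi /= Hr.
have /models_Tforall HN := elementary_models Hh (proj2 (models_Tforall M) HM).
have [_ Hc] := r02_sorts HN Hr.
exact/(elementary_iff (fP2 c) Hh).
Qed.

Lemma theta_bounds (M : struc L3) (r : pset M 1) (A : set M) : models M Tgen ->
  finite_set r -> r !=set0 -> delta_type Delta [set: M] r -> finite_set A ->
  (forall a, A a -> realizes (fun=> a) r) ->
  exists b : M, (forall a, A a -> sat2 theta (fun=> a) (fun=> b)) /\
    entails [set inst theta (fun=> b)] r.
Proof.
move=> HT fr [g0 rg0] Hr fA HA; have HM : Tforall_model M.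
  by apply/models_Tforall; case/models_Tgen: HT.
have [m] := carrier_nonempty M.
have /choice [c Hc] : forall g, exists c, r g -> g = inst phi (fun=> c).
  move=> g; have [/(delta_type_inst Hr) [c _ ->]|] := pselect (r g); first by exists c.
  by exists m.
have Hac a g : A a -> r g -> r02 a (c g).
  by move=> Aa rg; have := HA _ Aa _ rg; rewrite (Hc g rg) => /sat_inst_phi; rewrite -Hc.
have [b [bA bC]] : exists b : M, (forall a, A a -> r01 a b) /\ (forall d, (c @` r) d -> r12 b d).
  apply: finite_bound => //; first exact: finite_image.
  (* The formula [g0] of the nonempty [r] places the elements of [A] in sort 0. *)
  - by move=> a Aa; case: (r02_sorts HM (Hac _ _ Aa rg0)).
  - by move=> _ [g rg <-]; apply: (delta_type_sort HM Hr); rewrite -Hc.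
  - by move=> a _ Aa [g rg <-]; exact: Hac.
exists b; split=> [a Aa|N h a Hh Ha g rg]; first by apply/sat_R01; exact: bA.
have /models_Tforall HN := elementary_models Hh (proj2 (models_Tforall M) HM).
have /sat_inst_theta {}Ha := Ha _ erefl.
rewrite (Hc g rg); apply/sat_inst_phi/(r_comp HN Ha).
by apply/sat_R12/(elementary_iff _ Hh)/sat_R12/bC; exists g.
Qed.

Lemma card_le_ex T U (A : set T) (B : set U) (u : U) :
  A #<= B <-> exists2 f : T -> U, set_fun A B f & set_inj A f.
Proof.
elim/Ppointed: U => U in B u *; first by case: (no u).
rewrite -injfunPex; split; by [move/pcard_leP|move=> ?; apply/pcard_leP].
Qed.

Lemma card_le_trans_lt T U V (A : set T) (B : set U) (C : set V) :
  A #<= B -> card_lt B C -> card_lt A C.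
Proof.
move=> AB [BC nCB]; split; first exact: card_le_trans BC.
by move=> CA; apply: nCB; exact: card_le_trans AB.
Qed.

(** Hilbert's hotel: along a copy [f] of the naturals in [S], [y] goes to [f 0] and each [f n] to
    [f n.+1]; all other points stay. *)
Lemma infinite_setU1 T (S : set T) (y : T) : infinite_set S -> ~ S y -> S `|` [set y] #<= S.
Proof.
move=> /infiniteP /(card_le_ex _ _ y) [f fS fI] Sy.
have {}fI m n : f m = f n -> m = n by apply: fI; rewrite inE.
have {}fS n : S (f n) by exact: fS.
have /choice [s Hs] : forall x, exists x',
    [/\ x = y -> x' = f 0, forall n, x = f n -> x' = f n.+1
      & x <> y -> (forall n, x <> f n) -> x' = x].
  move=> x; have [->|xy] := pselect (x = y).
    by exists (f 0); split=> // n Hn; case: Sy; rewrite Hn.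
  have [[n ->]|Hn] := pselect (exists n, x = f n).
    by exists (f n.+1); split=> // [Hn|m /fI ->|_ /(_ n)] //; case: Sy; rewrite -Hn.
  by exists x; split=> // n En; case: Hn; exists n.
have cases x : (S `|` [set y]) x ->
    [\/ x = y /\ s x = f 0, exists2 n, x = f n & s x = f n.+1
      | [/\ S x, forall n, x <> f n & s x = x]].
  have [H1 H2 H3] := Hs x.
  have [xy|xy] := pselect (x = y); first by constructor 1; auto.
  have [[n xn]|Hn] := pselect (exists n, x = f n); first by constructor 2; exists n; auto.
  have {}Hn n : x <> f n by move=> Hx; apply: Hn; exists n.
  by case=> // Sx; constructor 3; split; auto.
apply/(card_le_ex _ _ y); exists s => [x /cases|x z].
  by case=> [[_ ->]|[n _ ->]|[? _ ->]].
rewrite !inE => /cases Hx /cases Hz.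
case: Hx Hz => [[-> ->]|[n -> ->]|[_ Hx ->]] [[-> ->]|[m -> ->]|[_ Hz ->]] // H.
- by have := fI _ _ H.
- by case: (Hz 0).
- by have := fI _ _ H.
- by have [->] := fI _ _ H.
- by case: (Hz n.+1).
- by case: (Hx 0).
- by case: (Hx m.+1).
Qed.

Lemma initial_segment_lt (mu : cardinal) (y : mu) : infinite_set [set: mu] ->
  card_lt [set x | cle x y] [set: mu].
Proof.
move=> Hinf; set S := [set x | cle x y /\ x <> y].
have sub : [set x | cle x y] `<=` S `|` [set y].
  by move=> x xy; have [->|] := pselect (x = y); [right|left].
have [fS|iS] := pselect (finite_set S).
  split; first exact: card_leT.
  move/card_le_finite => H; apply/Hinf/H/(sub_finite_set sub).
  by rewrite finite_setU; split.
apply: card_le_trans_lt (cle_initial y).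
apply: card_le_trans (subset_card_le sub) _.
by apply: infinite_setU1 => // -[].
Qed.

(** Saturation concerns complete types, so [p] is first completed to the full type over [A] of its
    realization [a]. *)
Lemma saturated_realizes (mu : cardinal) (M N : struc L3) (h : M -> N) (a : 'I_1 -> N)
    (A : set M) (p : pset M 1) :
  saturated mu M -> card_lt A [set: mu] -> p `<=` Defs.over A ->
  elementary h -> realizes_in h a p -> exists a0, realizes a0 p.
Proof.
move=> Hsat HA pA Hh Ha.
pose ev (v : 'I_1 + M) := match v with inl i => a i | inr c => h c end.
have [|a0 Ha0] := Hsat A HA 1 [set f | Defs.over A f /\ sat ev f].
  split=> [f []//||f Af]; first by exists N, h, a; split=> // f [].
  by have [?|?] := pselect (sat ev f); [left|right].
by exists a0 => f pf; apply: Ha0; split; [exact: pA|exact: Ha].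
Qed.

Lemma Tgen_singular_compactness : singular_compactness Tgen Delta.
Proof.
move=> M mu HT [Hinf [C [Hcof HC]]] _ Hsat A HA p Hp.
have HM : Tforall_model M by apply/models_Tforall; case/models_Tgen: HT.
have elem (N : struc L3) (h : M -> N) : models N Tgen -> agree id h -> elementary h.
  by move=> HN Hag f; exact: (proj1 (Tgen_sat f HT HN Hag)).
have [y0 _] : [set: mu] !=set0 by exact: infinite_setN0.
have /(card_le_ex _ _ y0) [g _ gI] := HA.
(* The pieces are pulled back along [g] from initial segments of [mu], hence smaller than [mu];
   since they increase with [y], those with [y] in the cofinal set [C] cover all parameters of sort
   2. *)
pose B y := [set c | [/\ A c, p2 c & cle (g c) y]].
have HB y : card_lt (B y) [set: mu].
  apply: card_le_trans_lt (initial_segment_lt y Hinf).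
  apply/(card_le_ex _ _ y); exists g => [c []//|c d]; rewrite !inE => -[Ac _ _] [Ad _ _].
  by apply: gI; rewrite inE.
have /choice [b Hb] : forall y, exists b : M, p1 b /\ forall c, B y c -> r12 b c.
  move=> y.
  (* With no sort-0 point below it, the added point may be related to all of [B y]. *)
  have HN0 : Tforall_model (with_point1 set0 (B y)) by apply: with_point1_Tforall => // c [].
  have [N [h [HN Hh]]] := Tgen_extend HN0.
  (* The sort is demanded explicitly because [B y] may be empty, and [with_top0] relates its new
     point only to points of sort 1. *)
  pose q : pset M 1 := fP1 (inl ord0) |` [set fR12 (inl ord0) (inr c) | c in B y].
  case/agreeP: (Hh) => _ Hh1 Hh2.
  have [|||a Ha] := @saturated_realizes mu M N (h \o Some) (fun=> h None) (B y) q Hsat (HB y).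
  - move=> f [->|]; first by rewrite /Defs.over.
    by case=> c Bc <-; rewrite /Defs.over /= => i; rewrite /pair_fun; case: ifP.
  - apply: elem => //; apply: agree_trans (with_point1_agree set0 (B y)) _.
    exact: (agree_comp Some Hh).
  - move=> f [->|[c Bc <-]]; first by case: (Hh1 None) => _ [H _] _; exact: H.
    by apply/sat_R12; case: (Hh2 None (Some c)) => _ _ [H _]; exact: H.
  exists (a ord0); split; first exact: (Ha _ (or_introl erefl)).
  move=> c Bc; have := Ha (fR12 (inl ord0) (inr c)) (or_intror (ex_intro2 _ _ c Bc erefl)).
  by move/sat_R12.
have [N [h [HN Hh]]] := Tgen_extend (with_top0_Tforall HM).
pose q : pset M 1 := [set fR01 (inl ord0) (inr d) | d in b @` C].
case/agreeP: (Hh) => _ Hh1 Hh2.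
have [||||a Ha] := @saturated_realizes mu M N (h \o Some) (fun=> h None) (b @` C) q Hsat.
- exact: card_le_trans_lt (card_image_le _ _) HC.
- by move=> _ [d bd <-]; rewrite /Defs.over /= => i; rewrite /pair_fun; case: ifP.
- apply: elem => //; apply: agree_trans (with_top0_agree M) _.
  exact: (agree_comp Some Hh).
- move=> _ [_ [y Cy <-] <-]; apply/sat_R01.
  by case: (Hh2 None (Some (b y))) => [[H _]] _ _; apply: H; case: (Hb y).
exists a => f pf; have [c Ac Ef] := delta_type_inst Hp pf; subst f.
have Hc := delta_type_sort HM Hp pf.
(* Cofinality places [c] in a piece [B y] with [y] in [C], and composition through [b y] yields the
   instance at [c]. *)
have [y [Cy gy]] := Hcof (g c); have [_ /(_ c) Hby] := Hb y.
apply/sat_inst_phi/(r_comp HM (b := b y)); last by apply: Hby; split.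
have /sat_R01 := Ha (fR01 (inl ord0) (inr (b y)))
  (ex_intro2 _ _ (b y) (ex_intro2 _ _ y Cy erefl) erefl).
exact.
Qed.

Theorem corollary5p10 :
  exists T : theory L3,
    [/\ model_completion Tforall T, NSOP 4 T, SOP 3 T,
        (forall M : struc L3, models M T ->
         forall r : pset M 1,
           finite_set r -> r !=set0 -> delta_type Delta [set: M] r ->
         forall A : set M, finite_set A ->
           (forall a, A a -> realizes (fun=> a) r) ->
         exists b : M,
           (forall a, A a -> sat2 theta (fun=> a) (fun=> b)) /\
           entails [set inst theta (fun=> b)] r)
      & singular_compactness T Delta].
Proof.
exists Tgen; split.
- exact: Tgen_model_completion.
- exact: Tgen_NSOP4.
- exact: Tgen_SOP3.
- by move=> M HT r fr r0 Hr A fA HA; exact: theta_bounds.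
- exact: Tgen_singular_compactness.
Qed.
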